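(* Let $n,k\ge1$, let $D_\pi,D_\sigma\in W(n)$ and let $Y(\pi,\sigma)=(Y_1,Y_2,Y_3,Y_4)$. Then the set $F(D_\pi,D_\sigma,k)$ of $k$-colourings $c\in\mathcal{C}_{n+1,k}$ of $D_\pi$ with $\mathcal{R}(D_\pi,c)=D_\sigma$ satisfies $$F(D_\pi,D_\sigma,k)=\bigcup_{A\subseteq Y_2,\;B\subseteq Y_3}\mathsf{WordEuler}_{n,k}\big(Y_1\cup A,\;(Y_2\cup Y_3)\setminus(A\cup B),\;Y_4\cup B\big),$$ and hence $$f(D_\pi,D_\sigma,k)=\sum_{A\subseteq Y_2,\;B\subseteq Y_3}\mathsf{wordeuler}_{n,k}\big(Y_1\cup A,\;(Y_2\cup Y_3)\setminus(A\cup B),\;Y_4\cup B\big).$$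
   Context: A 4-tuple $(x,y,a,b)$ is an edge from peg $x$ at height $a$ to peg $y$ at height $b$ (height 1 = bottom). $W(n)$ is the set of web diagrams on $n+2$ pegs $D=\{e_i=(i,i+1,x_i,y_{i+1}):1\le i\le n+1\}$ with $x_1=y_{n+2}=1$ and $\{x_i,y_i\}=\{1,2\}$ for $2\le i\le n+1$ (peg $i$, $2\le i\le n+1$, carries the right end of $e_{i-1}$ at height $y_i$ and the left end of $e_i$ at height $x_i$). $D$ is encoded by $\pi\in\{+1,-1\}^n$ with $\pi(i)=+1$ if $y_{i+1}=1,x_{i+1}=2$ and $\pi(i)=-1$ if $y_{i+1}=2,x_{i+1}=1$; write $D_\pi$. Reconstruction: $D\oplus D'=D\cup\{(x',y',a'+p_{x'}(D),b'+p_{y'}(D)):(x',y',a',b')\in D'\}$ with $p_i(D)$ the number of endpoints of $D$ on peg $i$; $\mathrm{rel}(X)$ relabels heights of endpoints of edges of $X$ on each peg by $1,\dots,\ell_i$ preserving relative order; a $k$-colouring of $D_\pi$ is $c\in\mathcal{C}_{n+1,k}$ (the set of sequences $(c(1),\dots,c(n+1))$ with $\{c(1),\dots,c(n+1)\}=\{1,\dots,k\}$), edge $e_i$ getting colour $c(i)$, and $\mathcal{R}(D,c)=\mathrm{rel}(D_c(1))\oplus\cdots\oplus\mathrm{rel}(D_c(k))$ with $D_c(t)$ the edges of colour $t$. For $c\in\mathcal{C}_{n+1,k}$: $\mathrm{Des}(c)=\{1\le i\le n:c(i)>c(i+1)\}$, $\mathrm{Equ}(c)=\{1\le i\le n:c(i)=c(i+1)\}$,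 $\mathrm{Asc}(c)=\{1\le i\le n:c(i)<c(i+1)\}$; $\mathsf{WordEuler}_{n,k}(X_1,X_2,X_3)=\{c\in\mathcal{C}_{n+1,k}:(\mathrm{Des}(c),\mathrm{Equ}(c),\mathrm{Asc}(c))=(X_1,X_2,X_3)\}$ and $\mathsf{wordeuler}_{n,k}$ is its cardinality. For $\pi,\sigma\in\{\pm1\}^n$: $Y_1=\{i:\pi_i=+1,\sigma_i=-1\}$, $Y_2=\{i:\pi_i=-1,\sigma_i=-1\}$, $Y_3=\{i:\pi_i=+1,\sigma_i=+1\}$, $Y_4=\{i:\pi_i=-1,\sigma_i=+1\}$ (subsets of $\{1,\dots,n\}$). *)

(* Defs.v *)
From mathcomp Require Import all_boot finmap.

Set Implicit Arguments.
Unset Strict Implicit.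
Unset Printing Implicit Defensive.

Local Open Scope fset_scope.
Local Open Scope nat_scope.

(* An edge (x, y, a, b) joins peg x at height a to peg y at height b; pegs and
   heights are numbered from 1. *)
Definition edge : Type := (nat * nat * nat * nat)%type.

Definition left_peg (e : edge) : nat := e.1.1.1.
Definition right_peg (e : edge) : nat := e.1.1.2.
Definition left_height (e : edge) : nat := e.1.2.
Definition right_height (e : edge) : nat := e.2.

(* p_i(D) *)
Definition nb_ends (D : {fset edge}) (i : nat) : nat :=
  #|` [fset e in D | left_peg e == i]| + #|` [fset e in D | right_peg e == i]|.

(* D (+) D' *)
Definition dsum (D D' : {fset edge}) : {fset edge} :=
  D `|` [fset (left_peg e, right_peg e,
               left_height e + nb_ends D (left_peg e),
               right_height e + nb_ends D (right_peg e)) | e in D'].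

Definition end_heights (X : {fset edge}) (i : nat) : {fset nat} :=
  [fset left_height e | e in X & left_peg e == i]
    `|` [fset right_height e | e in X & right_peg e == i].

(* The order-preserving relabelling by 1, 2, ... of the heights occurring on
   peg i sends h to the number of occurring heights that are at most h. *)
Definition rel_height (X : {fset edge}) (i h : nat) : nat :=
  #|` [fset h' in end_heights X i | h' <= h]|.

Definition rel_diagram (X : {fset edge}) : {fset edge} :=
  [fset (left_peg e, right_peg e,
         rel_height X (left_peg e) (left_height e),
         rel_height X (right_peg e) (right_height e)) | e in X].

(* The diagram of the edges e_i = (i, i+1, x_i, y_{i+1}), 1 <= i <= n+1. *)
Definition web_diagram (n : nat) (x y : nat -> nat) : {fset edge} :=
  [fset (i, i.+1, x i, y i.+1) | i in iota 1 n.+1].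

(* Membership in W(n). *)
Definition is_web (n : nat) (D : {fset edge}) : Prop :=
  exists x y : nat -> nat,
    [/\ x 1 = 1, y n.+2 = 1,
        forall i, 2 <= i <= n.+1 ->
          (x i = 1 /\ y i = 2) \/ (x i = 2 /\ y i = 1)
      & D = web_diagram n x y].

(* Elements of {+1, -1}^n: true stands for +1 and false for -1, and j : 'I_n
   stands for the position j+1 of {1, ..., n}; the latter convention holds for
   all sets of positions below. *)
Definition signs (n : nat) : Type := {ffun 'I_n -> bool}.

(* x_i = 2 iff pi(i-1) = +1, and y_i = 2 iff pi(i-1) = -1. *)
Definition xheight (n : nat) (pi : signs n) (i : nat) : nat :=
  if [exists j : 'I_n, (j.+2 == i) && pi j] then 2 else 1.
Definition yheight (n : nat) (pi : signs n) (i : nat) : nat :=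
  if [exists j : 'I_n, (j.+2 == i) && ~~ pi j] then 2 else 1.

(* D_pi *)
Definition web_of (n : nat) (pi : signs n) : {fset edge} :=
  web_diagram n (xheight pi) (yheight pi).

Lemma xheightE n (pi : signs n) (j : 'I_n) :
  xheight pi j.+2 = if pi j then 2 else 1.
Proof.
rewrite /xheight; case: existsP => [[i /andP[/eqP[/val_inj->] ->]] //|h].
by case: ifP => // pj; case: h; exists j; rewrite eqxx pj.
Qed.

Lemma yheightE n (pi : signs n) (j : 'I_n) :
  yheight pi j.+2 = if pi j then 1 else 2.
Proof.
rewrite /yheight; case: existsP => [[i /andP[/eqP[/val_inj->] /negbTE->]] //|h].
by case: ifPn => // pj; case: h; exists j; rewrite eqxx pj.
Qed.

Lemma xheight1 n (pi : signs n) : xheight pi 1 = 1.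
Proof. by rewrite /xheight; case: existsP => // -[]. Qed.

Lemma yheight_last n (pi : signs n) : yheight pi n.+2 = 1.
Proof.
rewrite /yheight; case: existsP => // -[j /andP[/eqP[jn] _]].
by move: (ltn_ord j); rewrite jn ltnn.
Qed.

Lemma is_webP n (D : {fset edge}) :
  is_web n D <-> exists pi : signs n, D = web_of pi.
Proof.
split=> [[x [y [x1 yn xy ->]]]|[pi ->]]; last first.
  exists (xheight pi), (yheight pi); split => //.
  - exact: xheight1.
  - exact: yheight_last.
  case=> [|[|i]] //= ltin; have := xheightE pi (Ordinal (ltin : i < n)).
  have := yheightE pi (Ordinal (ltin : i < n)) => /= -> ->.
  by case: ifP; [right | left].
pose pi := [ffun j : 'I_n => x j.+2 == 2]; exists pi.
have xE i : 1 <= i <= n.+1 -> x i = xheight pi i.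
  case: i => [|[|i]] //= ltin; first by rewrite xheight1.
  rewrite (xheightE pi (Ordinal (ltin : i < n))) ffunE /=.
  by have [[-> _]|[-> _]] := xy i.+2 ltin.
have yE i : 1 <= i <= n.+1 -> y i.+1 = yheight pi i.+1.
  case: i => [|i] //=; rewrite ltnS leq_eqVlt => /orP[/eqP->|ltin].
    by rewrite yn yheight_last.
  rewrite (yheightE pi (Ordinal ltin)) ffunE /=.
  by have [[-> ->]|[-> ->]] := xy i.+2 ltin.
apply/fsetP=> e; apply/imfsetP/imfsetP => -[i ii ->]; exists i => //;
  have : i \in iota 1 n.+1 by []; rewrite mem_iota add1n ltnS => hi;
  by rewrite xE ?yE.
Qed.

Lemma web_of_inj n : injective (@web_of n).
Proof.
move=> pi pi' eqD; apply/ffunP=> j.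
have : (j.+2, j.+3, xheight pi j.+2, yheight pi j.+3) \in web_of pi'.
  rewrite -eqD; apply/imfsetP; exists j.+2 => //.
  by change (j.+2 \in iota 1 n.+1); rewrite mem_iota add1n /= !ltnS.
case/imfsetP=> i /= _ [<-]; rewrite !xheightE.
by case: (pi j); case: (pi' j).
Qed.

(* C_{n+1,k}: the edge e_{i+1} gets the colour c i, and t : 'I_k stands for the
   colour t+1 of {1, ..., k}. *)
Definition colourings (n k : nat) : {set {ffun 'I_n.+1 -> 'I_k}} :=
  [set c : {ffun 'I_n.+1 -> 'I_k} | c @: [set: 'I_n.+1] == [set: 'I_k]].

(* D_c(t) for D in W(n): the edge e_i is the edge of D with left peg i. *)
Definition colour_class (n k : nat) (D : {fset edge})
    (c : {ffun 'I_n.+1 -> 'I_k}) (t : 'I_k) : {fset edge} :=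
  [fset e in D | c (inord (left_peg e).-1) == t].

(* R(D, c); the empty diagram is a left unit of dsum. *)
Definition reconstruction (n k : nat) (D : {fset edge})
    (c : {ffun 'I_n.+1 -> 'I_k}) : {fset edge} :=
  foldl dsum fset0 [seq rel_diagram (colour_class D c t) | t <- enum 'I_k].

(* F(D, D', k) for D, D' in W(n), and its cardinality f(D, D', k). *)
Definition Fset (n : nat) (D D' : {fset edge}) (k : nat) :
    {set {ffun 'I_n.+1 -> 'I_k}} :=
  [set c in colourings n k | reconstruction D c == D'].
Definition card_Fset (n : nat) (D D' : {fset edge}) (k : nat) : nat :=
  #|Fset n D D' k|.

(* For i : 'I_n, the consecutive letters are at widen_ord _ i and lift ord0 i,
   of values i and i+1. *)
Definition Des (n k : nat) (c : {ffun 'I_n.+1 -> 'I_k}) : {set 'I_n} :=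
  [set i : 'I_n | c (widen_ord (leqnSn n) i) > c (lift ord0 i)].
Definition Equ (n k : nat) (c : {ffun 'I_n.+1 -> 'I_k}) : {set 'I_n} :=
  [set i : 'I_n | c (widen_ord (leqnSn n) i) == c (lift ord0 i)].
Definition Asc (n k : nat) (c : {ffun 'I_n.+1 -> 'I_k}) : {set 'I_n} :=
  [set i : 'I_n | c (widen_ord (leqnSn n) i) < c (lift ord0 i)].

Definition WordEuler (n k : nat) (X1 X2 X3 : {set 'I_n}) :
    {set {ffun 'I_n.+1 -> 'I_k}} :=
  [set c in colourings n k | (Des c, Equ c, Asc c) == (X1, X2, X3)].
Definition wordeuler (n k : nat) (X1 X2 X3 : {set 'I_n}) : nat :=
  #|WordEuler k X1 X2 X3|.

Definition Y1 (n : nat) (pi sigma : signs n) : {set 'I_n} :=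
  [set i | pi i && ~~ sigma i].
Definition Y2 (n : nat) (pi sigma : signs n) : {set 'I_n} :=
  [set i | ~~ pi i && ~~ sigma i].
Definition Y3 (n : nat) (pi sigma : signs n) : {set 'I_n} :=
  [set i | pi i && sigma i].
Definition Y4 (n : nat) (pi sigma : signs n) : {set 'I_n} :=
  [set i | ~~ pi i && sigma i].

(* Main.v *)
(* On the interior peg between e_j and e_{j+1}, the class of the smaller colour
   is stacked below the other one, and the relative order of D_pi survives when
   the two colours agree.  Hence R(D_pi, c) = D_tau, where tau_j = +1 iff j is
   an ascent of c, or c(j) = c(j+1) and pi_j = +1.  So c is in F(D_pi, D_sigma, k)
   iff descents occur only where sigma = -1, ascents only where sigma = +1, and
   equalities only where sigma = pi; the sets A and B record the descents in Y_2
   and the ascents in Y_3. *)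
Require Import Defs.
From mathcomp Require Import all_boot zify finmap.

Set Implicit Arguments.
Unset Strict Implicit.
Unset Printing Implicit Defensive.

Local Open Scope fset_scope.
Local Open Scope nat_scope.

Lemma in_fset_filter (T : choiceType) (A : {fset T}) (P : pred T) (a : T) :
  (a \in [fset b in A | P b]) = (a \in A) && P a.
Proof. by rewrite !inE. Qed.

(** * End counts and relative heights in parts of a web diagram *)

Section Subdiagram.

Variables (n : nat) (x y : nat -> nat).

(** Colour classes and partial reconstructions both arise by selecting edges through their left
    pegs, so one computation of ends and heights serves both. *)
Definition subdiagram (P : pred nat) : {fset edge} :=
  [fset e in web_diagram n x y | P (left_peg e)].

Lemma subdiagramP (P : pred nat) (e : edge) :
  reflect (exists2 i, (0 < i <= n.+1) && P i & e = (i, i.+1, x i, y i.+1))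
          (e \in subdiagram P).
Proof.
rewrite !inE /=; apply: (iffP andP) => [[/imfsetP[i /= + ->] Pi]|[i /andP[hi Pi] ->]].
  by rewrite -[_ \in _]/(i \in iota 1 n.+1) mem_iota add1n ltnS => hi; exists i; rewrite ?hi.
split=> //; apply/imfsetP; exists i => //=.
by rewrite -[_ \in _]/(i \in iota 1 n.+1) mem_iota add1n ltnS.
Qed.

Lemma nb_ends_subdiagram (P : pred nat) (i : nat) :
  nb_ends (subdiagram P) i =
    ((0 < i <= n.+1) && P i) + ((1 < i <= n.+2) && P i.-1).
Proof.
rewrite /nb_ends; congr (_ + _).
- case: (boolP (_ && P i)) => [hi|/negP hi].
  + rewrite -[RHS](cardfs1 (i, i.+1, x i, y i.+1)); congr (#|` _|).
    apply/fsetP=> e; rewrite in_fset1 in_fset_filter; apply/andP/eqP.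
      by case=> /subdiagramP[j _ ->] /eqP /= <-.
    by move->; split=> //; apply/subdiagramP; exists i.
  + apply/eqP; rewrite cardfs_eq0; apply/eqP/fsetP=> e; rewrite in_fset0 in_fset_filter /=.
    apply/negP => /andP[/subdiagramP[j hj ->]] /eqP ji.
    by apply: hi; rewrite -ji.
- case: (boolP (_ && P i.-1)) => [hi|/negP hi].
  + rewrite -[RHS](cardfs1 (i.-1, i, x i.-1, y i)); congr (#|` _|).
    have ip : i.-1.+1 = i by lia.
    apply/fsetP=> e; rewrite in_fset1 in_fset_filter; apply/andP/eqP.
      by case=> /subdiagramP[j _ ->] /eqP /= <-.
    move->; split=> //; apply/subdiagramP; exists i.-1; last by rewrite ip.
    by case/andP: hi => hi ->; lia.
  + apply/eqP; rewrite cardfs_eq0; apply/eqP/fsetP=> e; rewrite in_fset0 in_fset_filter /=.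
    apply/negP => /andP[/subdiagramP[j hj ->]] /eqP /= ji.
    by apply: hi; rewrite -ji /right_peg /=; case/andP: hj => hj ->; lia.
Qed.

Lemma mem_end_heights_subdiagram (P : pred nat) (i h : nat) :
  (h \in end_heights (subdiagram P) i) =
    ((0 < i <= n.+1) && P i && (h == x i))
      || ((1 < i <= n.+2) && P i.-1 && (h == y i)).
Proof.
rewrite in_fsetU; congr (_ || _).
- apply/imfsetP/andP => [[e /=]|[hi /eqP->]].
    rewrite inE => /andP[/subdiagramP[j hj ->]] /eqP /= ji -> /=.
    by rewrite -ji hj.
  exists (i, i.+1, x i, y i.+1) => //=; rewrite inE /= eqxx andbT.
  by apply/subdiagramP; exists i.
- apply/imfsetP/andP => [[e /=]|[hi /eqP->]].
    rewrite inE => /andP[/subdiagramP[j hj ->]] /eqP /= ji -> /=.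
    by rewrite -ji /right_peg /=; case/andP: hj => hj ->; split=> //; lia.
  have ip : i.-1.+1 = i by lia.
  exists (i.-1, i, x i.-1, y i) => //=; rewrite inE /= eqxx andbT.
  apply/subdiagramP; exists i.-1; last by rewrite ip.
  by case/andP: hi => hi ->; lia.
Qed.

(** A peg carries at most two ends. [Q] says whether the second one, at height [b], is present; it
    raises the rank of [a] exactly when it lies below. *)
Lemma rel_height_two (X : {fset edge}) (i a b : nat) (Q : bool) :
  (Q -> a != b) ->
  (forall h, (h \in end_heights X i) = (h == a) || (Q && (h == b))) ->
  rel_height X i a = 1 + (Q && (b < a)).
Proof.
move=> ab memH; rewrite /rel_height.
case: (boolP (Q && _)) => [/andP[qT lt_ba]|/negP hba].
  transitivity #|` [fset a; b]|; last by rewrite cardfs2 (ab qT).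
  congr (#|` _|); apply/fsetP=> h; rewrite in_fset2 in_fset_filter /= memH qT /=.
  by case: (h =P a) => [->|_] /=; [rewrite leqnn|case: (h =P b) => [->|//]; rewrite ltnW].
rewrite -[RHS](cardfs1 a); congr (#|` _|); apply/fsetP=> h; rewrite in_fset1 in_fset_filter /= memH.
case: (h =P a) => [->|_] /=; first by rewrite leqnn.
apply/negP => /andP[/andP[qT /eqP->]] le_ba; apply: hba; rewrite qT.
by have := ab qT; lia.
Qed.

Hypothesis xy_neq : forall i, 1 < i <= n.+1 -> x i != y i.

Lemma rel_height_left (P : pred nat) (i : nat) :
  0 < i <= n.+1 -> P i ->
  rel_height (subdiagram P) i (x i) =
    1 + ((1 < i) && P i.-1 && (y i < x i)).
Proof.
move=> hi Pi; apply: rel_height_two => [/andP[i1 _]|h].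
  by apply: xy_neq; lia.
rewrite mem_end_heights_subdiagram hi Pi /=.
by have -> : (1 < i <= n.+2) = (1 < i) by lia.
Qed.

Lemma rel_height_right (P : pred nat) (i : nat) :
  0 < i <= n.+1 -> P i ->
  rel_height (subdiagram P) i.+1 (y i.+1) =
    1 + ((i <= n) && P i.+1 && (x i.+1 < y i.+1)).
Proof.
move=> hi Pi; apply: rel_height_two => [/andP[i1 _]|h].
  by rewrite eq_sym; apply: xy_neq; lia.
by rewrite mem_end_heights_subdiagram /= Pi orbC !ltnS hi.
Qed.

End Subdiagram.

(** * Reconstruction, one colour at a time *)

Section Reconstruction.

Variables (n k : nat) (pi : signs n) (c : {ffun 'I_n.+1 -> 'I_k}).

Definition rec_signs : signs n :=
  [ffun j => (c (widen_ord (leqnSn n) j) < c (lift ord0 j))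
             || ((c (widen_ord (leqnSn n) j) == c (lift ord0 j)) && pi j)].

(** The colour of $e_i$, with edges numbered from 1 and colours from 0. The default value of [inord]
    is never seen, since [subdiagram] only keeps $1 \le i \le n+1$. *)
Let col (i : nat) : nat := c (inord i.-1).

Let col_widen (j : 'I_n) : col j.+1 = c (widen_ord (leqnSn n) j).
Proof. by congr (val (c _)); apply: val_inj; rewrite /= inordK // ltnS ltnW. Qed.

Let col_lift (j : 'I_n) : col j.+2 = c (lift ord0 j).
Proof. by congr (val (c _)); apply: val_inj; rewrite /= inordK // ltnS. Qed.

Let rec_signsE (j : 'I_n) :
  rec_signs j = (col j.+1 < col j.+2) || ((col j.+1 == col j.+2) && pi j).
Proof. by rewrite ffunE col_widen col_lift. Qed.

Lemma xyheight_neq (s : signs n) (i : nat) :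
  1 < i <= n.+1 -> xheight s i != yheight s i.
Proof.
case: i => [|[|i]] //= ltin.
have := xheightE s (Ordinal (ltin : i < n)).
by have := yheightE s (Ordinal (ltin : i < n)) => /= -> ->; case: ifP.
Qed.

(** The loop invariant: once the colours less than [m] are stacked, their edges already have their
    final heights in $D_\tau$, because [dsum] never moves an edge of its first argument. *)
Let below (m : nat) := subdiagram n (xheight rec_signs) (yheight rec_signs)
                         (fun i => col i < m).
Let class (m : nat) := subdiagram n (xheight pi) (yheight pi)
                         (fun i => col i == m).

(** The only other end on peg $i$ belongs to $e_{i-1}$. A smaller colour there adds 1 through the
    shift; an equal colour adds 1 through the relabelling if [pi] puts that end below; a larger
    colour adds nothing. *)
Lemma stacked_left (i : nat) : 0 < i <= n.+1 ->
  rel_height (class (col i)) i (xheight pi i) + nb_ends (below (col i)) i =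
    xheight rec_signs i.
Proof.
move=> hi; rewrite /class rel_height_left //; last exact: xyheight_neq.
rewrite /below nb_ends_subdiagram ltnn andbF.
case: i hi => [|[|i]] //= ltin; first by rewrite xheight1.
have [xE yE] := (xheightE pi (Ordinal (ltin : i < n)), yheightE pi (Ordinal (ltin : i < n))).
have := xheightE rec_signs (Ordinal (ltin : i < n)).
rewrite rec_signsE /= in xE yE * => ->; rewrite xE yE.
have -> : i.+1 < n.+2 by lia.
by case: (pi _); case: (ltngtP (col i.+1) (col i.+2)).
Qed.

(** Mirror image of [stacked_left]: the competing end on peg $i+1$ is the left end of $e_{i+1}$. *)
Lemma stacked_right (i : nat) : 0 < i <= n.+1 ->
  rel_height (class (col i)) i.+1 (yheight pi i.+1)
    + nb_ends (below (col i)) i.+1 = yheight rec_signs i.+1.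
Proof.
move=> hi; rewrite /class rel_height_right //; last exact: xyheight_neq.
rewrite /below nb_ends_subdiagram /= ltnn !andbF addn0.
(* The edge $e_{n+1}$ is split off: its right end is alone on peg $n+2$. *)
case: i hi => [|i] //=; rewrite !ltnS leq_eqVlt => /orP[/eqP->|ltin].
  by rewrite !yheight_last !ltnn.
have [xE yE] := (xheightE pi (Ordinal (ltin : i < n)), yheightE pi (Ordinal (ltin : i < n))).
have := yheightE rec_signs (Ordinal (ltin : i < n)).
rewrite rec_signsE /= in xE yE * => ->; rewrite xE yE ltin.
by case: (pi _); case: (ltngtP (col i.+1) (col i.+2)).
Qed.

Lemma dsum_below (m : nat) :
  dsum (below m) (rel_diagram (class m)) = below m.+1.
Proof.
apply/fsetP=> e; rewrite in_fsetU; apply/orP/subdiagramP.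
- case=> [/subdiagramP[i /andP[hi cm] ->]|/imfsetP[e1 /= /imfsetP[e2 /=]]].
    by exists i; rewrite // hi ltnW.
  case/subdiagramP=> i /andP[hi /eqP <-] -> -> /= ->.
  by exists i; rewrite ?hi ?ltnSn // stacked_left ?stacked_right.
- case=> i /andP[hi]; rewrite ltnS leq_eqVlt => /orP[/eqP cm|cm] ->; last first.
    by left; apply/subdiagramP; exists i; rewrite ?hi.
  right; apply/imfsetP; eexists.
    apply/imfsetP; exists (i, i.+1, xheight pi i, yheight pi i.+1) => //=.
    by apply/subdiagramP; exists i; rewrite ?hi ?cm /=.
  by rewrite /= -cm stacked_left ?stacked_right.
Qed.

Lemma reconstruction_web : reconstruction (web_of pi) c = web_of rec_signs.
Proof.
(* Passing from ['I_k] to the numbers below [k] allows induction on the number of colours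
   stacked. *)
have -> : reconstruction (web_of pi) c =
    foldl (fun D m => dsum D (rel_diagram (class m))) fset0 (iota 0 k).
  rewrite /reconstruction -(val_enum_ord k).
  by elim: (enum 'I_k) fset0 => //= t s IHs D; rewrite IHs.
have foldE m :
    foldl (fun D i => dsum D (rel_diagram (class i))) fset0 (iota 0 m) = below m.
  elim: m => [|m IHm].
    by apply/fsetP=> e; rewrite in_fset0; apply/esym/subdiagramP => -[i]; rewrite andbF.
  by rewrite -addn1 iotaD foldl_cat IHm /= dsum_below addn1.
(* Every colour is less than [k], so [below k] is all of $D_\tau$. *)
by rewrite foldE; apply/fsetP=> e; rewrite in_fset_filter ltn_ord andbT.
Qed.

End Reconstruction.

(** * Descents, equalities and ascents of the colourings *)

Lemma in_Fset (n k : nat) (pi sigma : signs n) (c : {ffun 'I_n.+1 -> 'I_k}) :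
  (c \in Fset n (web_of pi) (web_of sigma) k) =
    (c \in colourings n k) && (rec_signs pi c == sigma).
Proof. by rewrite inE reconstruction_web (inj_eq (@web_of_inj n)). Qed.

(** The colouring determines [A] and [B], so the union in the theorem is disjoint and its
    cardinality is a plain sum. The equivalence holds position by position. *)
Lemma in_WordEuler (n k : nat) (pi sigma : signs n) (A B : {set 'I_n})
    (c : {ffun 'I_n.+1 -> 'I_k}) :
  A \subset Y2 pi sigma -> B \subset Y3 pi sigma ->
  (c \in WordEuler k (Y1 pi sigma :|: A)
           ((Y2 pi sigma :|: Y3 pi sigma) :\: (A :|: B)) (Y4 pi sigma :|: B)) =
  [&& c \in Fset n (web_of pi) (web_of sigma) k,
      Des c :&: Y2 pi sigma == A & Asc c :&: Y3 pi sigma == B].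
Proof.
move=> /subsetP sA /subsetP sB; rewrite in_Fset inE -andbA; congr (_ && _).
apply/eqP/and3P => [[/setP dE /setP eE /setP aE]|].
  split; apply/eqP; first apply/ffunP=> j; try apply/setP=> j;
  move: (dE j) (eE j) (aE j) (sA j) (sB j); rewrite ?ffunE !inE -?val_eqE /=;
  (* At one position, a finite check over the order of the two letters, the two signs and membership
     in [A] and [B]. *)
  by case: ltngtP; case: (pi j); case: (sigma j); case: (j \in A); case: (j \in B) => //= *; intuition.
case=> /eqP/ffunP sE /eqP/setP dE /eqP/setP aE.
congr (_, _, _); apply/setP=> j;
  move: (sE j) (dE j) (aE j) (sA j) (sB j); rewrite ?ffunE !inE -?val_eqE /=;
  by case: ltngtP; case: (pi j); case: (sigma j); case: (j \in A); case: (j \in B) => //= *; intuition.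
Qed.

Theorem theorem7p1 (n k : nat) (hn : 1 <= n) (hk : 1 <= k) (pi sigma : signs n) :
  Fset n (web_of pi) (web_of sigma) k =
    \bigcup_(A : {set 'I_n} | A \subset Y2 pi sigma)
     \bigcup_(B : {set 'I_n} | B \subset Y3 pi sigma)
      WordEuler k (Y1 pi sigma :|: A)
        ((Y2 pi sigma :|: Y3 pi sigma) :\: (A :|: B))
        (Y4 pi sigma :|: B)
  /\
  card_Fset n (web_of pi) (web_of sigma) k =
    \sum_(A : {set 'I_n} | A \subset Y2 pi sigma)
     \sum_(B : {set 'I_n} | B \subset Y3 pi sigma)
      wordeuler k (Y1 pi sigma :|: A)
        ((Y2 pi sigma :|: Y3 pi sigma) :\: (A :|: B))
        (Y4 pi sigma :|: B).
Proof.
split.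
  apply/setP=> c; apply/idP/bigcupP => [Fc|[A sA /bigcupP[B sB]]].
    exists (Des c :&: Y2 pi sigma); first exact: subsetIr.
    apply/bigcupP; exists (Asc c :&: Y3 pi sigma); first exact: subsetIr.
    by rewrite in_WordEuler ?subsetIr // Fc !eqxx.
  by rewrite in_WordEuler // => /andP[].
(* The colourings are sorted first by their descents in [Y2], then by their ascents in [Y3]; each
   resulting class is a [WordEuler] set. *)
rewrite /card_Fset -sum1_card
  (partition_big (fun c => Des c :&: Y2 pi sigma)
     (fun A : {set 'I_n} => A \subset Y2 pi sigma)) => [|c _] /=; last exact: subsetIr.
apply: eq_bigr => A sA.
rewrite (partition_big (fun c => Asc c :&: Y3 pi sigma)
     (fun B : {set 'I_n} => B \subset Y3 pi sigma)) => [|c _] /=; last exact: subsetIr.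
apply: eq_bigr => B sB; rewrite /wordeuler -sum1_card.
by apply: eq_bigl => c; rewrite in_WordEuler // andbA.
Qed.
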